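(* Every weakly norming graph is edge-transitive. That is, if $G$ is a finite simple graph such that $h \mapsto t_G(|h|)^{1/|E(G)|}$ is a norm on $\mathcal{H}$, then for any two edges $e, e'$ of $G$ there is an automorphism of $G$ mapping $e$ to $e'$.
   Context: Let $\mathcal{H}$ be the class of bounded measurable symmetric functions $h:[0,1]^2\to\mathbb{R}$ (with $h(x,y)=h(y,x)$), functions equal almost everywhere being identified. For a finite simple graph $G$ with vertex set $\{v_1,\ldots,v_n\}$ and nonempty edge set $E(G)$, and $h\in\mathcal{H}$, define the homomorphism density $$t_G(h)=\int_{[0,1]^n}\prod_{\{v_i,v_j\}\in E(G)} h(x_i,x_j)\,dx_1\cdots dx_n.$$ A graph $G$ is called weakly norming if $h\mapsto t_G(|h|)^{1/|E(G)|}$ is a norm on $\mathcal{H}$. *)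

(* Defs.v *)
From HB Require Import structures.
From mathcomp Require Import all_boot all_order all_algebra all_fingroup.
From mathcomp Require Import all_classical all_reals all_analysis.
Set Implicit Arguments. Unset Strict Implicit. Unset Printing Implicit Defensive.
Import Order.TTheory GRing.Theory Num.Theory.
Local Open Scope classical_set_scope.
Local Open Scope ring_scope.

Section Defs.
Variable R : realType.
Definition I01 : set R := `[0%R, 1%R].
Definition sq01 : set (R * R) := I01 `*` I01.

Fixpoint iint (k : nat) (F : seq R -> \bar R) : \bar R :=
  match k with
  | 0 => F [::]
  | k'.+1 => (\int[@lebesgue_measure R]_(x in I01) iint k' (fun s => F (x :: s)))%E
  end.

Definition in_H (h : R -> R -> R) : Prop :=
  [/\ measurable_fun sq01 (fun p : R * R => h p.1 p.2),
      (exists M : R, forall x y, x \in I01 -> y \in I01 -> `|h x y| <= M) &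
      (forall x y, x \in I01 -> y \in I01 -> h x y = h y x)].

(* edges of a simple graph on 'I_n, each unordered edge {i,j} listed once as (i,j), i<j *)
Definition edges (n : nat) (adj : rel 'I_n) : {set 'I_n * 'I_n} :=
  [set p : 'I_n * 'I_n | (nat_of_ord p.1 < nat_of_ord p.2)%N && adj p.1 p.2].

Definition tG (n : nat) (adj : rel 'I_n) (h : R -> R -> R) : \bar R :=
  iint n (fun s => (\prod_(p in edges adj) h (nth 0%R s (nat_of_ord p.1)) (nth 0%R s (nat_of_ord p.2)))%:E).

Definition tnorm (n : nat) (adj : rel 'I_n) (h : R -> R -> R) : R :=
  powR (fine (tG adj (fun x y => `|h x y|))) (#|edges adj|%:R)^-1.

(* weakly norming: tnorm is a norm on H (functions equal a.e. identified) *)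
Definition weakly_norming (n : nat) (adj : rel 'I_n) : Prop :=
  [/\ (forall f g, in_H f -> in_H g ->
         tnorm adj (fun x y => f x y + g x y) <= tnorm adj f + tnorm adj g),
      (forall (c : R) f, in_H f -> tnorm adj (fun x y => c * f x y) = `|c| * tnorm adj f) &
      (forall f, in_H f -> tnorm adj f = 0 ->
         ((@lebesgue_measure R) \x (@lebesgue_measure R))%E.-negligible
           (sq01 `&` [set p | f p.1 p.2 != 0]))].

Definition simple_graph (n : nat) (adj : rel 'I_n) : Prop :=
  [/\ symmetric adj, irreflexive adj & exists u v, adj u v].

Definition edge_transitive (n : nat) (adj : rel 'I_n) : Prop :=
  forall u v u' v' : 'I_n, adj u v -> adj u' v' ->
    exists s : {perm 'I_n},
      (forall x y, adj (s x) (s y) = adj x y) /\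
      ((s u == u') && (s v == v') || (s u == v') && (s v == u')).
End Defs.

(* Main.v *)
(* For step functions the norm axiom says that N(w) = P(w)^(1/m) is subadditive, where
   P(w) is the weighted homomorphism count into a finite target and m = #|E|.  Write
   t_e(w, u) for the count with weight u on the edge e and w on all other edges.  The
   derivative of N(w + t u) <= N(w) + t N(u) at t = 0 gives
   \sum_e t_e(w, u) <= m P(w)^(1 - 1/m) P(u)^(1/m), and the tensor power trick turns
   this into t_e(w, u)^m <= P(w)^(m - 1) P(u) for every single edge e.  Putting
   u = w + t r and differentiating again, t_e(w, r) is at most the average of the
   t_f(w, r) over all edges f, so t_e(w, r) is independent of e.  Taking the graph itself
   as target, with w the indicator of a set of edges and r that of one edge a, and sieving
   over subsets, the number of maps sending e to a and the other edges onto E \ a does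
   not depend on e either.  For e = a the identity is such a map; for any other e such a
   map is an automorphism sending e to a. *)
Require Import Defs.
From HB Require Import structures.
From mathcomp Require Import all_boot all_order all_algebra all_fingroup.
From mathcomp Require Import all_classical all_reals all_analysis.
From mathcomp Require Import measurable_realfun ring lra.
Set Implicit Arguments. Unset Strict Implicit. Unset Printing Implicit Defensive.
Import Order.TTheory GRing.Theory Num.Theory.
Local Open Scope ring_scope.

(** * Linear coefficients of polynomials, and two limiting arguments over the reals *)

Lemma coef1M (A : comNzRingType) (p q : {poly A}) :
  (p * q)`_1 = p`_0 * q`_1 + p`_1 * q`_0.
Proof. by rewrite coefM big_ord_recl big_ord1. Qed.

Lemma coef0X (A : comNzRingType) (p : {poly A}) (m : nat) : (p ^+ m)`_0 = p`_0 ^+ m.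
Proof. by elim: m => [|m IHm]; rewrite ?expr0 ?coefC // !exprS coef0M IHm. Qed.

Lemma coef0_affine (A : comNzRingType) (a b : A) : (a%:P + b%:P * 'X)`_0 = a.
Proof. by rewrite coefD coefC coefMX /= addr0. Qed.

Lemma coef1_affine (A : comNzRingType) (a b : A) : (a%:P + b%:P * 'X)`_1 = b.
Proof. by rewrite coefD coefC coefMX /= coefC add0r. Qed.

(** Leibniz rule at 0, with derivatives read off as coefficients of ['X]. *)
Lemma coef1_prod_affine (A : comNzRingType) (I : eqType) (s : seq I) (a b : I -> A) :
  uniq s ->
  (\prod_(i <- s) ((a i)%:P + (b i)%:P * 'X))`_1 =
  \sum_(e <- s) \prod_(i <- s) (if i == e then b i else a i).
Proof.
elim: s => [|x s IHs] /=; first by rewrite !big_nil coefC.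
case/andP=> xs us; rewrite !big_cons coef1M coef0_affine coef1_affine IHs // eqxx addrC.
congr (_ + _).
  congr (_ * _); rewrite coef0_prod; apply: eq_big_seq => i si.
  by rewrite coef0_affine; case: eqP xs => // <-; rewrite si.
rewrite big_distrr /=; apply: eq_big_seq => e se.
by rewrite big_cons; case: eqP xs => [->|//]; rewrite se.
Qed.

Lemma coef1X (A : comNzRingType) (p : {poly A}) (m : nat) :
  (p ^+ m)`_1 = p`_0 ^+ m.-1 * p`_1 *+ m.
Proof.
elim: m => [|[|m] IHm]; first by rewrite expr0 coefC mulr0n.
  by rewrite expr1 expr0 mul1r.
rewrite exprS coef1M IHm coef0X /= mulrnAr mulrA -exprS [p`_1 * _]mulrC.
by rewrite addrC -mulrS.
Qed.

(** Here [p = q * 'X] with [q] nonnegative on t > 0, hence at 0 by continuity. This differentiates a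
    polynomial inequality on t > 0 that is an equality at 0. *)
Lemma coef1_ge0 (R : realType) (p : {poly R}) :
  p`_0 = 0 -> (forall x, 0 < x -> 0 <= p.[x]) -> 0 <= p`_1.
Proof.
move=> p0 pge.
have /factor_theorem [q pE] : root p 0 by rewrite /root horner_coef0 p0.
rewrite subr0 in pE.
have qge x : 0 < x -> 0 <= q.[x].
  by move=> x0; have := pge _ x0; rewrite pE hornerMX pmulr_lge0.
have -> : p`_1 = q.[0] by rewrite pE coefMX /= horner_coef0.
have qc : (q.[x] @[x --> (0 : R)^'+] --> q.[0])%classic.
  by apply: cvg_at_right_filter; exact: continuous_horner.
rewrite -(cvg_lim _ qc) //; apply: limr_ge; first exact: cvgP qc.
by near=> x; apply: qge; near: x; exact: nbhs_right_gt.
Unshelve. all: by end_near. Qed.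

(** If x > y > 0, Bernoulli's inequality makes (x / y) ^ (2 ^ k) exceed any constant [c]. Exponents
    are powers of 2 because tensor squaring will be iterated. *)
Lemma le_of_expn_le (R : realType) (x y c : R) :
  0 <= x -> 0 <= y ->
  (forall k, x ^+ (2 ^ k) <= c * y ^+ (2 ^ k)) -> x <= y.
Proof.
move=> x0 y0 H; rewrite leNgt; apply/negP => yx.
have xp : 0 < x by apply: le_lt_trans yx.
move: y0; rewrite le_eqVlt => /predU1P [y0|yp].
  by have := H 0%N; rewrite -y0 !expr1 mulr0 leNgt xp.
set d := x / y - 1.
have d0 : 0 < d by rewrite /d subr_gt0 ltr_pdivlMr // mul1r.
have B k : 1 + k%:R * d <= (x / y) ^+ k.
  have -> : x / y = 1 + d by rewrite /d; ring.
  elim: k => [|k IHk]; first by rewrite mul0r addr0 expr0.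
  rewrite exprS; apply: (@le_trans _ _ ((1 + d) * (1 + k%:R * d))).
    rewrite -natr1; have : 0 <= k%:R * d * d by rewrite !mulr_ge0 // ltW.
    lra.
  by rewrite ler_wpM2l // addr_ge0 // ltW.
have [k Hk] : exists k : nat, c < k%:R * d.
  exists (Num.bound `|c / d|); rewrite -ltr_pdivrMr //.
  exact: le_lt_trans (ler_norm _) (archi_boundP (normr_ge0 _)).
have := H k; rewrite -ler_pdivrMr ?exprn_gt0 // -expr_div_n => Hle.
have := B (2 ^ k)%N; have : (k%:R : R) <= (2 ^ k)%:R by rewrite ler_nat ltnW // ltn_expl.
move=> /(ler_wpM2r (ltW d0)); lra.
Qed.

(** * Weighted homomorphism sums into a finite target *)

Section HomSum.
Variables (V : finType) (E : {set V * V}).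

(** The weight may depend on the edge, so that one edge can be marked; a constant family gives
    P(w). *)
Definition hom_sum (A : comNzRingType) (T : finType) (W : V * V -> T -> T -> A) : A :=
  \sum_(phi : {ffun V -> T}) \prod_(p in E) W p (phi p.1) (phi p.2).

Definition hom_mark (A : comNzRingType) (T : finType) (w u : T -> T -> A) (e : V * V) : A :=
  hom_sum (fun p => if p == e then u else w).

Lemma hom_sum_ge0 (R : realType) (T : finType) (W : V * V -> T -> T -> R) :
  (forall p x y, 0 <= W p x y) -> 0 <= hom_sum W.
Proof. by move=> W0; apply: sumr_ge0 => phi _; apply: prodr_ge0. Qed.

Lemma hom_sum_tensor (A : comNzRingType) (T T' : finType)
    (W : V * V -> T -> T -> A) (W' : V * V -> T' -> T' -> A) :
  hom_sum (fun p (x y : T * T') => W p x.1 y.1 * W' p x.2 y.2) =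
  hom_sum W * hom_sum W'.
Proof.
rewrite /hom_sum big_distrlr pair_big /=.
pose h (q : {ffun V -> T} * {ffun V -> T'}) : {ffun V -> T * T'} :=
  [ffun v => (q.1 v, q.2 v)].
pose h' (phi : {ffun V -> T * T'}) : {ffun V -> T} * {ffun V -> T'} :=
  ([ffun v => (phi v).1], [ffun v => (phi v).2]).
rewrite (reindex h) /=; last first.
  exists h' => [[q1 q2] _|phi _].
    by congr pair; apply/ffunP => v; rewrite !ffunE.
  by apply/ffunP => v; rewrite !ffunE /=; case: (phi v).
by apply: eq_bigr => q _; rewrite -big_split; apply: eq_bigr => p _; rewrite !ffunE.
Qed.

Lemma hom_mark_tensor (A : comNzRingType) (T T' : finType)
    (w u : T -> T -> A) (w' u' : T' -> T' -> A) (e : V * V) :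
  hom_mark (fun x y : T * T' => w x.1 y.1 * w' x.2 y.2)
           (fun x y => u x.1 y.1 * u' x.2 y.2) e =
  hom_mark w u e * hom_mark w' u' e.
Proof.
rewrite /hom_mark -hom_sum_tensor; apply: eq_bigr => phi _.
by apply: eq_bigr => p _; case: ifP.
Qed.

(** This is P(w + u X), computed over [{poly A}]; its linear coefficient is the derivative in
    direction [u]. *)
Definition hom_line (A : comNzRingType) (T : finType) (w u : T -> T -> A) : {poly A} :=
  hom_sum (fun _ x y => (w x y)%:P + (u x y)%:P * 'X).

Lemma horner_hom_line (A : comNzRingType) (T : finType) (w u : T -> T -> A) t :
  (hom_line w u).[t] = hom_sum (fun _ x y => w x y + u x y * t).
Proof.
rewrite horner_sum; apply: eq_bigr => phi _; rewrite horner_prod.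
by apply: eq_bigr => p _; rewrite !hornerE.
Qed.

Lemma coef0_hom_line (A : comNzRingType) (T : finType) (w u : T -> T -> A) :
  (hom_line w u)`_0 = hom_sum (fun _ => w).
Proof.
rewrite -horner_coef0 horner_hom_line; apply: eq_bigr => phi _.
by apply: eq_bigr => p _; rewrite mulr0 addr0.
Qed.

Lemma coef1_hom_line (A : comNzRingType) (T : finType) (w u : T -> T -> A) :
  (hom_line w u)`_1 = \sum_(e in E) hom_mark w u e.
Proof.
rewrite coef_sum; etransitivity; last exact: exchange_big; apply: eq_bigr => phi _ /=.
rewrite -big_enum /= coef1_prod_affine ?enum_uniq // big_enum.
by apply: eq_bigr => e _; rewrite big_enum; apply: eq_bigr => p _; case: ifP.
Qed.

Lemma hom_markE (A : comNzRingType) (T : finType) (w : T -> T -> A) e :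
  hom_mark w w e = hom_sum (fun _ => w).
Proof. by apply: eq_bigr => phi _; apply: eq_bigr => p _; case: ifP. Qed.

(** The edge [e] contributes exactly one factor to each product, so the count is linear in its
    weight. *)
Lemma hom_mark_add (A : comNzRingType) (T : finType) (w u r : T -> T -> A) e t :
  e \in E ->
  hom_mark w (fun x y => u x y + r x y * t) e = hom_mark w u e + hom_mark w r e * t.
Proof.
move=> eE; rewrite mulr_suml -big_split; apply: eq_bigr => phi _ /=.
rewrite !(bigD1 e eE) /= !eqxx mulrDl mulrAC.
by congr (_ * _ + _ * _ * _); apply: eq_bigr => p /andP [_ /negPf ->].
Qed.

End HomSum.

(** * From the triangle inequality to counts independent of the marked edge *)

Section Triangle.
Variables (R : realType) (V : finType) (E : {set V * V}).
Notation m := #|E|.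

Definition nonneg_sym (T : finType) (w : T -> T -> R) :=
  (forall x y, 0 <= w x y) /\ (forall x y, w x y = w y x).

Definition root_hom (T : finType) (w : T -> T -> R) : R :=
  powR (hom_sum E (fun _ => w)) m%:R^-1.

Definition hom_triangle := forall (T : finType) (w u : T -> T -> R),
  nonneg_sym w -> nonneg_sym u ->
  root_hom (fun x y => w x y + u x y) <= root_hom w + root_hom u.

Hypothesis m_gt0 : (0 < m)%N.
Hypothesis tri : hom_triangle.

Lemma root_homX (T : finType) (w : T -> T -> R) : nonneg_sym w ->
  root_hom w ^+ m = hom_sum E (fun _ => w).
Proof.
move=> [w0 _]; rewrite -powR_mulrn ?powR_ge0 // -powRrM mulVf ?pnatr_eq0 ?lt0n_neq0 //.
by rewrite powRr1 // hom_sum_ge0.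
Qed.

Lemma root_homZ (T : finType) (w : T -> T -> R) t : 0 <= t -> nonneg_sym w ->
  root_hom (fun x y => w x y * t) = root_hom w * t.
Proof.
move=> t0 [w0 ws].
have H : hom_sum E (fun _ x y => w x y * t) = hom_sum E (fun _ => w) * t ^+ m.
  rewrite mulr_suml; apply: eq_bigr => phi _.
  by rewrite big_split /= prodr_const.
rewrite /root_hom H powRM ?exprn_ge0 ?hom_sum_ge0 //; congr (_ * _).
by rewrite -powR_mulrn // -powRrM divff ?pnatr_eq0 ?lt0n_neq0 // powRr1.
Qed.

(* First order part at 0 of [P(w + t u) <= (N w + t N u) ^ m]. *)
Lemma sum_hom_mark_le (T : finType) (w u : T -> T -> R) :
  nonneg_sym w -> nonneg_sym u ->
  \sum_(e in E) hom_mark E w u e <= m%:R * root_hom w ^+ m.-1 * root_hom u.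
Proof.
move=> wn un.
pose p := ((root_hom w)%:P + (root_hom u)%:P * 'X) ^+ m - hom_line E w u.
have := @coef1_ge0 R p; rewrite /p !coefB coef0X coef1X coef0_affine coef1_affine.
rewrite coef0_hom_line coef1_hom_line root_homX // subrr => /(_ erefl).
rewrite -mulr_natl mulrA subr_ge0; apply => t t0.
rewrite !hornerE horner_hom_line subr_ge0.
have utn : nonneg_sym (fun x y => u x y * t).
  case: un => u0 us; split=> x y; last by rewrite us.
  by rewrite mulr_ge0 // ltW.
rewrite -root_homX; last first.
  case: wn utn => w0 ws [u0 us]; split => x y; last by rewrite ws us.
  by rewrite addr_ge0.
rewrite lerXn2r ?nnegrE ?powR_ge0 //.
  by rewrite addr_ge0 ?mulr_ge0 ?powR_ge0 // ltW.
by rewrite -root_homZ ?(ltW t0) //; apply: tri.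
Qed.

(** One term of a nonnegative sum is at most the sum; the m-th power clears the roots, at the price
    of [m ^ m]. *)
Lemma hom_mark_le_weak (T : finType) (w u : T -> T -> R) e : e \in E ->
  nonneg_sym w -> nonneg_sym u ->
  hom_mark E w u e ^+ m <=
  m%:R ^+ m * (hom_sum E (fun _ => w) ^+ m.-1 * hom_sum E (fun _ => u)).
Proof.
move=> eE wn un.
have t0 f : 0 <= hom_mark E w u f.
  by apply: hom_sum_ge0 => p x y; case: ifP => _; [apply: un.1 | apply: wn.1].
rewrite -(root_homX wn) -(root_homX un) -exprM mulnC exprM mulrA -!exprMn.
rewrite lerXn2r ?nnegrE //; first by rewrite !mulr_ge0 ?exprn_ge0 ?powR_ge0.
apply: le_trans (sum_hom_mark_le wn un).
by rewrite (bigD1 e eE) /= lerDl sumr_ge0.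
Qed.

(* Tensor powers remove the factor [m ^ m]. *)
Lemma hom_mark_le (T : finType) (w u : T -> T -> R) e : e \in E ->
  nonneg_sym w -> nonneg_sym u ->
  hom_mark E w u e ^+ m <= hom_sum E (fun _ => w) ^+ m.-1 * hom_sum E (fun _ => u).
Proof.
move=> eE wn un; apply: (@le_of_expn_le _ _ _ (m%:R ^+ m)).
- apply: exprn_ge0; apply: hom_sum_ge0 => p x y.
  by case: ifP => _; [apply: un.1 | apply: wn.1].
- by rewrite mulr_ge0 ?exprn_ge0 ?hom_sum_ge0 // => ???; [apply: wn.1|apply: un.1].
(* The target varies in the induction: exponent 2 ^ (k + 1) over [T] is exponent 2 ^ k over [T * T]
   with tensor squares as weights, and the constant is the same for every target. *)
move=> k; elim: k T w u wn un => [|k IHk] T w u wn un.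
  by rewrite !expr1; apply: hom_mark_le_weak.
have sq (v : T -> T -> R) : nonneg_sym v ->
    nonneg_sym (fun x y : T * T => v x.1 y.1 * v x.2 y.2).
  by case=> v0 vs; split => x y; [rewrite mulr_ge0 | rewrite vs (vs x.2)].
have := IHk _ _ _ (sq _ wn) (sq _ un).
rewrite hom_mark_tensor !(hom_sum_tensor E (fun _ => _) (fun _ => _)).
by rewrite expnS mul2n -addnn !exprD !exprMn mulrACA.
Qed.

(** No t_f(w, r) exceeds the average over all edges, so all equal it. The bound divides by a power
    of P(w), so P(w) = 0 is treated separately. *)
Lemma hom_mark_eq (T : finType) (w r : T -> T -> R) e e' : e \in E -> e' \in E ->
  nonneg_sym w -> nonneg_sym r -> hom_mark E w r e = hom_mark E w r e'.
Proof.
move=> eE e'E wn rn.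
have t0 f : 0 <= hom_mark E w r f.
  by apply: hom_sum_ge0 => p x y; case: ifP => _; [apply: rn.1 | apply: wn.1].
have P0 : 0 <= hom_sum E (fun _ => w) by apply: hom_sum_ge0 => _; apply: wn.1.
(* A single edge leaves nothing to compare; afterwards m - 1 > 0, so P(w) = 0 gives 0 ^ (m - 1) =
   0. *)
have [m1|m1] := leqP m 1.
  have /eqP/cards1P [x Ex] : m = 1%N by apply/eqP; rewrite eqn_leq m1.
  by move: eE e'E; rewrite Ex !inE => /eqP -> /eqP ->.
move: P0; rewrite le_eqVlt => /predU1P [P0|Pp].
  have z f : f \in E -> hom_mark E w r f = 0.
    move=> fE; have := hom_mark_le fE wn rn.
    rewrite -P0 expr0n -subn1 subn_eq0 leqNgt m1 mul0r => le0.
    have : hom_mark E w r f ^+ m == 0 by rewrite eq_le le0 exprn_ge0.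
    by rewrite expf_eq0 => /andP [_ /eqP].
  by rewrite !z.
have avg f : f \in E ->
    m%:R * hom_mark E w r f <= \sum_(g in E) hom_mark E w r g.
  move=> fE.
  pose P := hom_sum E (fun _ => w).
  (* For u = w + t r the marked count is P + t t_f(w, r), so [hom_mark_le] makes [p] nonnegative for
     t > 0; at 0 both terms are P ^ m. *)
  pose p := (P ^+ m.-1)%:P * hom_line E w r - (P%:P + (hom_mark E w r f)%:P * 'X) ^+ m.
  have := @coef1_ge0 R p; rewrite /p !coefB coef0X coef1X !coefCM coef0_affine coef1_affine.
  rewrite coef0_hom_line coef1_hom_line -exprSr prednK // subrr => /(_ erefl).
  rewrite -mulrnAr subr_ge0.
  rewrite ler_pM2l ?exprn_gt0 // mulr_natl; apply => t tp.
  rewrite !hornerE horner_hom_line subr_ge0.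
  have := @hom_mark_le _ w (fun x y => w x y + r x y * t) f fE wn.
  rewrite hom_mark_add // hom_markE; apply.
  case: wn rn => w0 ws [r0 rs]; split => x y; last by rewrite ws rs.
  by rewrite addr_ge0 // mulr_ge0 // ltW.
have eqavg f : f \in E -> m%:R * hom_mark E w r f = \sum_(g in E) hom_mark E w r g.
  move=> fE; apply/eqP.
  (* The gaps to the average, scaled by m, are nonnegative and add up to 0, so each vanishes. *)
  have : \sum_(g in E) (\sum_(h in E) hom_mark E w r h - m%:R * hom_mark E w r g) = 0.
    by rewrite sumrB sumr_const -mulr_sumr mulr_natl subrr.
  move/eqP; rewrite psumr_eq0; last by move=> g gE; rewrite subr_ge0 avg.
  by move=> /allP /(_ f (mem_index_enum _)); rewrite fE /= subr_eq0 eq_sym.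
have m0 : (m%:R : R) != 0 by rewrite pnatr_eq0 lt0n_neq0.
by apply: (mulfI m0); rewrite !eqavg.
Qed.

End Triangle.

(** * Step functions on [0, 1] with blocks of equal length *)

Section StepFunctions.
Variables (R : realType) (T : finType) (t0 : T).
Local Notation N := #|T|.
Local Notation mu := (@lebesgue_measure R).

Lemma cardT_gt0 : 0 < N%:R :> R.
Proof. by rewrite ltr0n; apply/card_gt0P; exists t0. Qed.

Definition block (i : T) : interval R :=
  `[(enum_rank i)%:R / N%:R, (enum_rank i).+1%:R / N%:R[.

(** The default [t0] is taken outside [0, 1), in particular at the endpoint 1. *)
Definition cell (x : R) : T := odflt t0 [pick i | x \in block i].

Lemma block_inj x i j : x \in block i -> x \in block j -> i = j.
Proof.
have le a b : x \in block a -> x \in block b -> (enum_rank a <= enum_rank b)%N.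
  rewrite !in_itv /= => /andP [ax _] /andP [_ xb].
  have := le_lt_trans ax xb.
  by rewrite ltr_pM2r ?invr_gt0 ?cardT_gt0 // ltr_nat ltnS.
move=> xi xj; apply: enum_rank_inj; apply: val_inj; apply/eqP.
by rewrite eqn_leq !le.
Qed.

Lemma block_cover x : 0 <= x < 1 -> exists i, x \in block i.
Proof.
have N0 := cardT_gt0.
case/andP => x0 x1; have /truncn_itv /andP [le lt] : 0 <= x * N%:R by rewrite mulr_ge0 // ltW.
have kN : (Num.truncn (x * N%:R) < N)%N.
  by rewrite -(ltr_nat R); apply: le_lt_trans le _; rewrite gtr_pMl.
exists (enum_val (Ordinal kN)); rewrite /block in_itv /= enum_valK /=.
by rewrite ler_pdivrMr // ltr_pdivlMr // le.
Qed.

(** Values relative to [g t0] make the formula valid on all reals, since [cell] is [t0] off the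
    blocks. *)
Lemma step_indic (g : T -> R) x : g (cell x) =
  g t0 + \sum_i (g i - g t0) * \1_([set` block i]%classic) x.
Proof.
have ind i : \1_([set` block i]%classic) x = (x \in block i)%:R :> R.
  by rewrite indicE mem_setE.
rewrite /cell; case: pickP => [i xi|nx] /=.
  rewrite (bigD1 i) //= big1 ?ind ?xi; first by rewrite mulr1 addr0 addrC subrK.
  move=> j ji; rewrite ind; case: (boolP (x \in block j)) => [xj|_]; last by rewrite mulr0.
  by rewrite (block_inj xi xj) eqxx in ji.
by rewrite big1 ?addr0 // => j _; rewrite ind nx mulr0.
Qed.

Lemma measurable_step (g : T -> R) : measurable_fun setT (fun x : R => g (cell x)).
Proof.
rewrite (_ : (fun x => _) = (fun x => g t0 +
    \sum_i (g i - g t0) * \1_([set` block i]%classic) x)); last first.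
  by apply: funext => x; exact: step_indic.
apply: measurable_funD => //; apply: measurable_sum => i.
by apply: measurable_funM => //; apply: measurable_indic.
Qed.

Lemma integral_step (g : T -> R) : (forall i, 0 <= g i) ->
  (\int[mu]_(x in @I01 R) (g (cell x))%:E)%E = ((\sum_i g i) / N%:R)%:E.
Proof.
move=> g0; have N0 := cardT_gt0.
(* The endpoint 1 lies in no block; being a null set, it is dropped first. *)
rewrite /I01 -integral_itv_bndo_bndc; last first.
  apply/measurable_EFinP; apply: measurable_funTS; exact: measurable_step.
transitivity (\int[mu]_(x in `[0%R, 1%R[)
    (\sum_i (g i * \1_([set` block i]%classic) x)%:E))%E.
  apply: eq_integral => x; rewrite inE /= in_itv /= => /block_cover [i xi].
  rewrite (bigD1 i) //= big1 => [|j ji].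
    rewrite indicE mem_setE xi /= mulr1 adde0 /cell.
    by case: pickP => [j xj|/(_ i)]; rewrite /= ?(block_inj xi xj) // xi.
  rewrite indicE mem_setE; case: (boolP (x \in block j)) => [xj|_]; last by rewrite mulr0.
  by rewrite (block_inj xi xj) eqxx in ji.
rewrite ge0_integral_sum //; last 2 first.
- move=> i; apply/measurable_EFinP; apply: measurable_funTS.
  by apply: measurable_funM => //; apply: measurable_indic.
- by move=> i x _; rewrite lee_fin mulr_ge0.
rewrite mulr_suml -sumEFin; apply: eq_bigr => i _.
under eq_integral do rewrite EFinM.
rewrite ge0_integralZl //; last 2 first.
- apply/measurable_EFinP; apply: measurable_funTS; exact: measurable_indic.
- by rewrite lee_fin.
rewrite integral_indic //=.
rewrite setIidl; last first.
  move=> x; rewrite /= !in_itv /= => /andP [ix xi]; apply/andP; split.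
    by apply: le_trans ix; rewrite divr_ge0 // ltW.
  apply: (lt_le_trans xi); rewrite ler_pdivrMr // mul1r ler_nat; exact: ltn_ord.
have lti : (enum_rank i)%:R / N%:R < (enum_rank i).+1%:R / N%:R :> R.
  by rewrite ltr_pM2r ?invr_gt0 // ltr_nat.
rewrite EFinM lebesgue_measure_itv /= lte_fin lti -EFinB -mulrBl.
by rewrite -natr1 addrC addKr mul1r.
Qed.

Lemma big_tuple_cons k (F : seq T -> R) :
  \sum_(s : k.+1.-tuple T) F s = \sum_(x : T) \sum_(s : k.-tuple T) F (x :: s).
Proof.
rewrite pair_big (reindex (fun p : T * k.-tuple T => [tuple of p.1 :: p.2])) //=.
exists (fun s => (thead s, [tuple of behead s])) => [[x s] _|s _] /=.
  by rewrite theadE; congr pair; apply: val_inj.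
by rewrite [RHS]tuple_eta; apply: val_inj.
Qed.

(** Integrating the later variables leaves a function of the cell of the first one, to which
    [integral_step] applies. *)
Lemma iint_step k (F : seq T -> R) : (forall s, 0 <= F s) ->
  iint k (fun s => (F (map cell s))%:E) = ((\sum_(s : k.-tuple T) F s) / N%:R ^+ k)%:E.
Proof.
elim: k F => [|k IHk] F F0 /=.
  rewrite (big_pred1 [tuple]) ?expr0 ?divr1 //.
  by move=> s; apply/esym/eqP; exact: tuple0.
pose G i := (\sum_(s : k.-tuple T) F (i :: s)) / N%:R ^+ k.
transitivity (\int[mu]_(x in @I01 R) (G (cell x))%:E)%E.
  by apply: eq_integral => x _; rewrite (IHk (fun s => F (cell x :: s))).
rewrite integral_step; last by move=> i; rewrite /G divr_ge0 ?exprn_ge0 // sumr_ge0.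
by rewrite big_tuple_cons -mulr_suml exprSr invfM mulrA mulrAC.
Qed.

Definition step_fun (w : T -> T -> R) (x y : R) : R := w (cell x) (cell y).

Lemma step_fun_in_H (w : T -> T -> R) : nonneg_sym w -> in_H (step_fun w).
Proof.
case=> w0 ws; split.
- apply: measurable_funTS.
  rewrite (_ : (fun p => _) = (fun p : R * R => \sum_i \sum_j
      w i j * ((cell p.1 == i)%:R * (cell p.2 == j)%:R))); last first.
    apply: funext => p; rewrite (bigD1 (cell p.1)) //= (bigD1 (cell p.2)) //=.
    rewrite !eqxx !mulr1 big1 => [|j /negPf nj]; last by rewrite eq_sym nj !mulr0.
    rewrite big1 ?addr0 // => i /negPf ni.
    by rewrite big1 // => j _; rewrite eq_sym ni mul0r mulr0.
  apply: measurable_sum => i; apply: measurable_sum => j.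
  apply: measurable_funM => //; apply: measurable_funM.
    exact: (measurableT_comp (measurable_step (fun t => (t == i)%:R)) measurable_fst).
  exact: (measurableT_comp (measurable_step (fun t => (t == j)%:R)) measurable_snd).
- exists (\sum_i \sum_j w i j) => x y _ _; rewrite /step_fun ger0_norm //.
  rewrite (bigD1 (cell x)) //= (bigD1 (cell y)) //= -addrA lerDl.
  by rewrite addr_ge0 ?sumr_ge0 // => i _; rewrite sumr_ge0.
- by move=> x y _ _; exact: ws.
Qed.

Lemma tG_step (n : nat) (adj : rel 'I_n) (w : T -> T -> R) : nonneg_sym w ->
  tG adj (step_fun w) = (hom_sum (edges adj) (fun _ => w) / N%:R ^+ n)%:E.
Proof.
(* The default [cell 0] matches the default 0 in [tG], so [nth] commutes with [map cell] at every
   index. *)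
case=> w0 _; pose F (s : seq T) : R := \prod_(p in edges adj)
   w (nth (cell 0) s (nat_of_ord p.1)) (nth (cell 0) s (nat_of_ord p.2)).
have nth_cell (s : seq R) k : nth (cell 0) (map cell s) k = cell (nth 0 s k).
  have [ks|ks] := ltnP k (size s); first exact: nth_map.
  by rewrite !nth_default // size_map.
rewrite /tG (_ : (fun s => _) = (fun s => (F (map cell s))%:E)); last first.
  by apply: funext => s; congr EFin; apply: eq_bigr => p _; rewrite !nth_cell.
rewrite iint_step; last by move=> s; apply: prodr_ge0.
congr (_ / _)%:E; rewrite /hom_sum.
rewrite (reindex (fun phi : {ffun 'I_n -> T} => [tuple phi i | i < n])) /=; last first.
  exists (fun s => [ffun i => tnth s i]) => [phi _|s _].
    by apply/ffunP => i; rewrite ffunE tnth_mktuple.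
  by apply: eq_from_tnth => i; rewrite tnth_mktuple ffunE.
apply: eq_bigr => phi _; apply: eq_bigr => p _.
have nth_phi (i : 'I_n) : nth (cell 0) [seq phi j | j <- enum 'I_n] i = phi i.
  by rewrite (nth_map i) ?size_enum_ord // nth_ord_enum.
by rewrite /= !nth_phi.
Qed.

(** The factor N ^ (-n / m) depends only on the target and the graph, so it cancels from the
    triangle inequality. *)
Lemma tnorm_step (n : nat) (adj : rel 'I_n) (w : T -> T -> R) : nonneg_sym w ->
  tnorm adj (step_fun w) =
  root_hom (edges adj) w * powR (N%:R ^- n) #|edges adj|%:R^-1.
Proof.
move=> wn; rewrite /tnorm.
rewrite (_ : (fun x y => _) = step_fun w); last first.
  by apply: funext => x; apply: funext => y; rewrite ger0_norm //; apply: wn.1.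
rewrite tG_step // /= powRM ?invr_ge0 ?exprn_ge0 //.
by apply: hom_sum_ge0 => p; apply: wn.1.
Qed.

End StepFunctions.

(** A sum of step functions is the step function of the summed weights, so the norm axiom transfers
    to finite targets. *)
Lemma weakly_norming_triangle (R : realType) (n : nat) (adj : rel 'I_n) :
  simple_graph adj -> weakly_norming R adj -> hom_triangle R (edges adj).
Proof.
move=> [_ _ [u0 _]] [tri _ _] T w u wn un.
(* An empty target has no [t0]; there every sum is empty, as the graph has a vertex [u0], and the
   claim reads a <= a + a with a >= 0. *)
case: (pickP (fun _ : T => true)) => [t0 _|T0]; last first.
  have P0 v : hom_sum (edges adj) (fun _ : _ * _ => v : T -> T -> R) = 0.
    by rewrite /hom_sum big1 // => phi; have := T0 (phi u0).
  rewrite /root_hom !P0; have := powR_ge0 (0 : R) #|edges adj|%:R^-1; lra.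
have wun : nonneg_sym (fun x y => w x y + u x y).
  case: wn un => w0 ws [v0 vs]; split => x y; last by rewrite ws vs.
  by rewrite addr_ge0.
have := tri _ _ (step_fun_in_H t0 wn) (step_fun_in_H t0 un).
rewrite -/(step_fun t0 (fun x y => w x y + u x y)).
rewrite !tnorm_step // -mulrDl ler_pM2r // powR_gt0 // invr_gt0 exprn_gt0 //.
exact: (cardT_gt0 R t0).
Qed.

(** * The graph as its own target: sieving and automorphisms *)

Section Combinatorics.
Variables (n : nat) (adj : rel 'I_n).
Hypothesis sg : simple_graph adj.
Notation E := (edges adj).

Definition ord_pair (x y : 'I_n) : 'I_n * 'I_n :=
  if (x < y)%N then (x, y) else (y, x).

Lemma ord_pairC x y : ord_pair x y = ord_pair y x.
Proof. by rewrite /ord_pair; case: (ltngtP x y) => // xy; rewrite (ord_inj xy). Qed.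

Lemma ord_pair_edge x y : (ord_pair x y \in E) = adj x y.
Proof.
have [adjC adjN _] := sg.
rewrite /ord_pair inE; case: (ltngtP x y) => //= [->|-> |xy]; rewrite //= ?(ord_inj xy) ?ltnn ?adjN //.
Qed.

Lemma edge_ord_pair p : p \in E -> ord_pair p.1 p.2 = p.
Proof. by case: p => x y; rewrite inE /ord_pair => /andP [/= -> _]. Qed.

Definition edge_map (phi : 'I_n -> 'I_n) (p : 'I_n * 'I_n) := ord_pair (phi p.1) (phi p.2).

Lemma edge_map_ord_pair phi x y : edge_map phi (ord_pair x y) = ord_pair (phi x) (phi y).
Proof. by rewrite {1}/ord_pair; case: ifP => _ //=; rewrite /edge_map /= ord_pairC. Qed.

Definition indic_w (R : realType) (S : {set 'I_n * 'I_n}) (x y : 'I_n) : R :=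
  (ord_pair x y \in S)%:R.

Lemma nonneg_sym_indic R S : nonneg_sym (@indic_w R S).
Proof. by split => x y; rewrite /indic_w ?ler0n // ord_pairC. Qed.

Definition maps_onto (a e : 'I_n * 'I_n) (S : {set 'I_n * 'I_n}) :=
  [set phi : {ffun 'I_n -> 'I_n} |
    (edge_map phi e == a) && (edge_map phi @: (E :\ e) == S)].

(** The product of indicators is 1 precisely for maps sending [e] to [a] and the other edges into
    [S]; these are sorted by their exact image [S']. *)
Lemma hom_mark_indic R (S : {set 'I_n * 'I_n}) a e : e \in E ->
  hom_mark E (@indic_w R S) (indic_w R [set a]) e =
  (\sum_(S' : {set 'I_n * 'I_n} | S' \subset S) #|maps_onto a e S'|)%:R.
Proof.
move=> eE.
have -> : (\sum_(S' : {set 'I_n * 'I_n} | S' \subset S) #|maps_onto a e S'|)%N =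
    #|[set phi : {ffun 'I_n -> 'I_n} |
       (edge_map phi e == a) && (edge_map phi @: (E :\ e) \subset S)]|.
  rewrite -sum1_card (partition_big (fun phi : {ffun 'I_n -> 'I_n} => edge_map phi @: (E :\ e))
    (fun S' => S' \subset S)) /=; last by move=> phi; rewrite inE => /andP [].
  apply: eq_bigr => S' S'S; rewrite -sum1_card; apply: eq_bigl => phi.
  by rewrite !inE -andbA; congr (_ && _); case: eqP => [->|]; rewrite ?S'S ?andbT ?andbF.
rewrite -sum1_card natr_sum big_mkcond; apply: eq_bigr => phi _.
rewrite inE (bigD1 e eE) /= eqxx {1}/indic_w inE -/(edge_map phi e).
case: (edge_map phi e == a); last by rewrite mul0r.
rewrite mul1r /=; case: ifP => [/fintype.subsetP sub|nsub].
  rewrite big1 // => p /andP [pE pe]; rewrite (negPf pe) /indic_w -/(edge_map phi p).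
  by rewrite sub //; apply: imset_f; apply/setD1P.
move/negbT: nsub => /fintype.subsetPn [_ /imsetP [p /setD1P [pe pE] ->] pS].
rewrite (bigD1 p) /=; last by apply/andP; split.
rewrite (negPf pe).
by rewrite /indic_w -/(edge_map phi p) (negPf pS) mul0r.
Qed.

(** Induction on the size of [S]: the marked counts are sums over all subsets of [S], and the terms
    for proper subsets already agree. *)
Lemma card_maps_onto_eq (R : realType) e e' a S : e \in E -> e' \in E ->
  (forall S, hom_mark E (@indic_w R S) (indic_w R [set a]) e =
             hom_mark E (@indic_w R S) (indic_w R [set a]) e') ->
  #|maps_onto a e S| = #|maps_onto a e' S|.
Proof.
move=> eE e'E H; have [k] := ubnP #|S|; elim: k S => // k IHk S Sk.
have := H S; rewrite !hom_mark_indic // => /eqP; rewrite eqr_nat => /eqP.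
rewrite (bigD1 S) //= [in RHS](bigD1 S) //=.
have -> : (\sum_(S' : {set 'I_n * 'I_n} | (S' \subset S) && (S' != S)) #|maps_onto a e S'|)%N =
          (\sum_(S' : {set 'I_n * 'I_n} | (S' \subset S) && (S' != S)) #|maps_onto a e' S'|)%N.
  apply: eq_bigr => S' /andP [S'S nS]; apply: IHk.
  apply: leq_trans (_ : #|S| <= k)%N; last by rewrite -ltnS.
  by apply: proper_card; rewrite finset.properEneq nS.
exact: addIn.
Qed.

(* [phi] maps the set of non-isolated vertices onto itself, hence injectively; it is
   extended by the identity. *)
Lemma edge_map_onto_aut (phi : {ffun 'I_n -> 'I_n}) :
  edge_map phi @: E = E ->
  exists s : {perm 'I_n},
    (forall x y, adj (s x) (s y) = adj x y) /\ (forall x y, adj x y -> s x = phi x).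
Proof.
move=> phiE; have [adjC adjN _] := sg.
pose V0 := [set x | [exists y, adj x y]].
have adjV0 x y : adj x y -> x \in V0 by move=> xy; rewrite inE; apply/existsP; exists y.
have phi_adj x y : adj x y -> adj (phi x) (phi y).
  rewrite -!ord_pair_edge => xy.
  by rewrite -edge_map_ord_pair -phiE; apply: imset_f.
(* Every edge is the image of an edge; [ord_pair] forgets the order, so the preimage may have to be
   reversed. *)
have phi_lift x y : adj x y -> exists x' y', [/\ adj x' y', phi x' = x & phi y' = y].
  rewrite -ord_pair_edge -{1}phiE => /imsetP [[a b] abE].
  have ab : adj a b by rewrite -ord_pair_edge (edge_ord_pair abE).
  rewrite /edge_map /= /ord_pair.
  by do 2 case: ifP => _; case => -> ->; first [by exists a, b | by exists b, a; rewrite adjC].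
have phiV0 : phi @: V0 = V0.
  apply/setP => x; apply/imsetP/idP => [[y /[!inE] /existsP [z yz] ->]|].
    by apply/existsP; exists (phi z); apply: phi_adj.
  rewrite inE => /existsP [y /phi_lift [x' [y' [x'y' <- _]]]].
  by exists x' => //; apply: adjV0 x'y'.
have phi_inj : {in V0 &, injective phi} by apply/imset_injP; rewrite phiV0.
pose f x := if x \in V0 then phi x else x.
have fV0 x : (f x \in V0) = (x \in V0).
  rewrite /f; case: ifP => // xV; by rewrite -phiV0 imset_f.
have f_inj : injective f.
  move=> x y fxy; have := fV0 x; rewrite fxy fV0 => yx.
  move: fxy; rewrite /f yx; case: ifP => // xV.
  by apply: phi_inj => //; rewrite yx.
exists (perm f_inj); split=> x y; last by move/adjV0 => xV; rewrite permE /f xV.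
rewrite !permE; apply/idP/idP => [fxy|xy]; last first.
  by rewrite /f (adjV0 _ _ xy) (adjV0 y x) ?phi_adj // adjC.
have xV : x \in V0 by rewrite -fV0; apply: adjV0 fxy.
have yV : y \in V0 by rewrite -fV0; apply: adjV0 (f x) _; rewrite adjC.
move: fxy; rewrite /f xV yV => /phi_lift [x' [y' [x'y' /phi_inj ex /phi_inj ey]]].
by rewrite -ex ?(adjV0 _ _ x'y') // -ey // (adjV0 y' x') // adjC.
Qed.

Lemma edge_transitive_of_marks (R : realType) :
  (forall e e' S a, e \in E -> e' \in E ->
    hom_mark E (@indic_w R S) (indic_w R [set a]) e =
    hom_mark E (@indic_w R S) (indic_w R [set a]) e') ->
  edge_transitive adj.
Proof.
move=> H u v u' v' uv u'v'.
set e' := ord_pair u v; set e := ord_pair u' v'.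
have eE : e \in E by rewrite ord_pair_edge.
have e'E : e' \in E by rewrite ord_pair_edge.
have idE : edge_map (finfun id) @: (E :\ e) = E :\ e.
  rewrite -[RHS]imset_id; apply: eq_in_imset => p /setD1P [_ pE].
  by rewrite /edge_map !ffunE edge_ord_pair.
(* The identity is counted when [e] itself is marked, so some [phi] sends [e'] to [e] and the other
   edges onto the rest. *)
have : (0 < #|maps_onto e e' (E :\ e)|)%N.
  rewrite -(@card_maps_onto_eq R e) //; last by move=> S; apply: H.
  apply/card_gt0P; exists (finfun id).
  by rewrite inE idE eqxx andbT /edge_map !ffunE edge_ord_pair.
case/card_gt0P => phi; rewrite inE => /andP [/eqP phie /eqP phiS].
have phiE : edge_map phi @: E = E.
  have /= <- := congr1 (fun S : {set _} => edge_map phi @: S) (finset.setD1K e'E).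
  by rewrite imsetU1 phie phiS finset.setD1K.
have [s [saut sphi]] := edge_map_onto_aut phiE.
exists s; split=> //.
have [adjC _ _] := sg.
have su := sphi _ _ uv; have sv : s v = phi v by apply: (sphi v u); rewrite adjC.
rewrite su sv; move: phie; rewrite /edge_map /e' /e /ord_pair.
by case: (u < v)%N => /=; do 2 case: ifP => _; case=> -> ->; rewrite !eqxx ?orbT.
Qed.

End Combinatorics.

Theorem theorem1 (R : realType) (n : nat) (adj : rel 'I_n) :
  simple_graph adj -> weakly_norming R adj -> edge_transitive adj.
Proof.
move=> sg wn; have tri := weakly_norming_triangle sg wn.
apply: (edge_transitive_of_marks sg (R := R)) => e e' S a eE e'E.
have m_gt0 : (0 < #|edges adj|)%N by apply/card_gt0P; exists e.
exact: (hom_mark_eq m_gt0 tri eE e'E (nonneg_sym_indic R S) (nonneg_sym_indic R [set a])).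
Qed.
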